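(* Suppose there is an algorithm which, given any integer linear recurrence sequence $\langle u_n\rangle_{n=0}^\infty$ of order $6$, decides whether there exists $N$ such that $u_n\ge 0$ for all $n\ge N$ (i.e. the Ultimate Positivity Problem is decidable for integer LRS of order $6$). Then for every $t\in\mathcal{T}$, the Lagrange constant $L_\infty(t)$ is a computable real number.
   Context: An integer linear recurrence sequence (LRS) of order $k$ is a sequence $\langle u_n\rangle_{n=0}^\infty$ of integers for which there are integers $a_1,\ldots,a_k$ with $a_k\ne 0$ such that $u_{n+k}=a_1u_{n+k-1}+\cdots+a_ku_n$ for all $n\ge0$; it is given as input by the $2k$-tuple $(a_1,\ldots,a_k,u_0,\ldots,u_{k-1})$. For a real number $x$, the Lagrange constant is $L_\infty(x)=\inf\{c\in\mathbb{R}: |x-\frac{n}{m}|<\frac{c}{m^2} \text{ for infinitely many pairs } (n,m) \text{ with } n,m\in\mathbb{Z},\ m\neq 0\}$. Let $\mathcal{A}=\{p+qi\in\mathbb{C}: p,q\in\mathbb{Q},\ p^2+q^2=1,\ p\neq 0,\ q\neq 0\}$, and let $\mathcal{T}=\{\frac{\arg\alpha}{2\pi}:\alpha\in\mathcal{A}\}$, where $\arg$ denotes the principal argument with values in $(-\pi,\pi]$. A real number $x$ is computable if there is an algorithm which, given any rational $\varepsilon>0$, returns a rational $q$ with $|q-x|<\varepsilon$. *)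

(* Defs.v *)
From Stdlib Require Import Reals ZArith QArith List Lra Lia.
From Coquelicot Require Import Coquelicot.
Import ListNotations.
Open Scope R_scope.

(* Model of computation: partial (mu-)recursive functions on lists of  *)
(* naturals.  An "algorithm" is a program [e : prf]; [eval e v y] means *)
(* that e halts on input v with output y.                              *)
Inductive prf : Type :=
| PZero : prf
| PSucc : prf
| PProj : nat -> prf
| PComp : prf -> list prf -> prf
| PRec  : prf -> prf -> prf
| PMu   : prf -> prf.

Inductive eval : prf -> list nat -> nat -> Prop :=
| eval_zero v : eval PZero v 0
| eval_succ x v : eval PSucc (x :: v) (S x)
| eval_proj i v : (i < length v)%nat -> eval (PProj i) v (nth i v 0%nat)
| eval_comp f gs v ws y :
    evals gs v ws -> eval f ws y -> eval (PComp f gs) v y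
| eval_rec0 f g v y : eval f v y -> eval (PRec f g) (0%nat :: v) y
| eval_recS f g n v r y :
    eval (PRec f g) (n :: v) r -> eval g (n :: r :: v) y ->
    eval (PRec f g) (S n :: v) y
| eval_mu f v n :
    eval f (n :: v) 0%nat ->
    (forall m, (m < n)%nat -> exists k, eval f (m :: v) (S k)) ->
    eval (PMu f) v n
with evals : list prf -> list nat -> list nat -> Prop :=
| evals_nil v : evals [] v []
| evals_cons g gs v y ys :
    eval g v y -> evals gs v ys -> evals (g :: gs) v (y :: ys).

Definition zcode (z : Z) : nat :=
  if (0 <=? z)%Z then Z.to_nat (2 * z) else Z.to_nat (- 2 * z - 1).

Definition pair_code (a b : nat) : nat := ((a + b) * (a + b + 1) / 2 + b)%nat.

Definition qinput (q : Q) : list nat := [zcode (Qnum q); Pos.to_nat (Qden q)].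

Definition computable_real (x : R) : Prop :=
  exists e : prf, forall eps : Q, (0 < eps)%Q ->
    exists (a : Z) (b : nat),
      (0 < b)%nat /\
      eval e (qinput eps) (pair_code (zcode a) b) /\
      Rabs (IZR a / INR b - x) < Q2R eps.

(* [lrs a u] with a = [a1;...;ak], u = [u0;...;u_{k-1}] is the sequence *)
(* u_{n+k} = a1 u_{n+k-1} + ... + ak u_n.                               *)
Definition lrs_step (a s : list Z) : list Z :=
  tl s ++ [fold_right Z.add 0%Z (map (fun p => (fst p * snd p)%Z) (combine a (rev s)))].

Definition lrs (a u : list Z) (n : nat) : Z := hd 0%Z (Nat.iter n (lrs_step a) u).

Definition lrs_input (k : nat) (a u : list Z) : Prop :=
  length a = k /\ length u = k /\ nth (k - 1) a 0%Z <> 0%Z.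

Definition ultimately_nonneg (a u : list Z) : Prop :=
  exists N : nat, forall n, (N <= n)%nat -> (0 <= lrs a u n)%Z.

Definition UPP_decidable (k : nat) : Prop :=
  exists e : prf, forall a u : list Z, lrs_input k a u ->
    (ultimately_nonneg a u -> eval e (map zcode (a ++ u)) 1%nat) /\
    (~ ultimately_nonneg a u -> eval e (map zcode (a ++ u)) 0%nat).

Definition approx_pair (x c : R) (p : Z * Z) : Prop :=
  snd p <> 0%Z /\ Rabs (x - IZR (fst p) / IZR (snd p)) < c / (IZR (snd p)) ^ 2.

Definition lagrange_admissible (x c : R) : Prop :=
  ~ exists l : list (Z * Z), forall p, approx_pair x c p -> In p l.

Definition lagrange_const (x : R) : Rbar := Glb_Rbar (lagrange_admissible x).

(* The set T: t = arg(alpha)/(2 pi), alpha = p + q i, p,q in Q\{0},     *)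
(* p^2+q^2 = 1, arg the principal argument in (-pi, pi].  For |alpha|=1 *)
(* arg alpha is the unique theta in (-pi,pi] with cos = p, sin = q.     *)
Definition in_T (t : R) : Prop :=
  exists (p q : Q) (theta : R),
    ~ (p == 0)%Q /\ ~ (q == 0)%Q /\ (p * p + q * q == 1)%Q /\
    - PI < theta <= PI /\ cos theta = Q2R p /\ sin theta = Q2R q /\
    t = theta / (2 * PI).

(* Main.v *)
Require Import Defs.
From Stdlib Require Import Reals ZArith QArith List Lra Lia Qreals Classical ClassicalEpsilon.
From Coquelicot Require Import Coquelicot.
Import ListNotations.
Open Scope R_scope.

(** Write [alpha = exp (2 pi i t) = (a + b i) / d] with integers [a, b, d]. For naturals
    [r1, r2 > 0] the integer sequences
    [d^n (r2 n (1 - cos (2 pi n t)) -/+ r1 sin (2 pi n t))] satisfy a common recurrence of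
    order 6. With [y = pi (n t - p)], [p] the integer nearest to [n t], such a term is
    [2 d^n sin y (r2 n sin y -/+ r1 cos y)], so up to lower-order effects one of the two is
    negative exactly when [|t - p/n| < (r1 / (r2 pi)) / n^2]. Hence an oracle for ultimate
    positivity tells [L <= r1 / (r2 pi)] from [L >= r1 / (r2 pi)], either answer being
    possible at equality. Running [r1 / r2] through the multiples of
    [pi_M / M], where [pi_M] is a partial sum of the Leibniz series, the first index [j] at
    which [L <= r1 / (r2 pi)] is reported gives the approximation [j / M] of [L]. The
    search ends because Dirichlet's theorem gives [L <= 1]; it concerns irrational [t]
    only, as rational [t] have [L = 0]. *)

(** * Total recursive functions *)

(** Only lists of length [k] count, so the default value of [nth] is never reached for an index
    below [k]. *)
Definition recursive (k : nat) (f : list nat -> nat) : Prop :=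
  exists e, forall v, length v = k -> eval e v (f v).

Lemma recursive_ext k f g :
  (forall v, length v = k -> f v = g v) -> recursive k f -> recursive k g.
Proof. intros H [e He]; exists e; intros v Hv; rewrite <- H; auto. Qed.

Lemma recursive_nth k i : (i < k)%nat -> recursive k (fun v => nth i v 0%nat).
Proof. intros H; exists (PProj i); intros v Hv; constructor; lia. Qed.

Lemma recursive_evals k (fs : list (list nat -> nat)) :
  List.Forall (recursive k) fs ->
  exists es, forall v, length v = k -> evals es v (map (fun g => g v) fs).
Proof.
  induction 1 as [|g gs [e He] _ [es Hes]].
  - exists []; intros; constructor.
  - exists (e :: es); intros v Hv; constructor; auto.
Qed.

Lemma recursive_comp k (fs : list (list nat -> nat)) f :
  List.Forall (recursive k) fs -> recursive (length fs) f ->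
  recursive k (fun v => f (map (fun g => g v) fs)).
Proof.
  intros Hfs [e He]; destruct (recursive_evals k fs Hfs) as [es Hes].
  exists (PComp e es); intros v Hv.
  econstructor; [exact (Hes v Hv)|].
  apply He; now rewrite length_map.
Qed.

Lemma recursive_comp1 k f g :
  recursive 1 (fun v => f (nth 0 v 0%nat)) -> recursive k g ->
  recursive k (fun v => f (g v)).
Proof.
  intros Hf Hg.
  apply (recursive_comp k [g] (fun v => f (nth 0 v 0%nat))); auto.
Qed.

Lemma recursive_comp2 k f g h :
  recursive 2 (fun v => f (nth 0 v 0%nat) (nth 1 v 0%nat)) ->
  recursive k g -> recursive k h -> recursive k (fun v => f (g v) (h v)).
Proof.
  intros Hf Hg Hh.
  apply (recursive_comp k [g; h] (fun v => f (nth 0 v 0%nat) (nth 1 v 0%nat))); auto.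
Qed.

Lemma recursive_succ k g : recursive k g -> recursive k (fun v => S (g v)).
Proof.
  apply (recursive_comp1 k S).
  exists PSucc; intros [|x v] Hv; [discriminate|constructor].
Qed.

Lemma recursive_const k c : recursive k (fun _ => c).
Proof.
  induction c as [|c IH].
  - exists PZero; intros; constructor.
  - now apply recursive_succ.
Qed.

Lemma recursive_prec k f g h :
  recursive k f -> recursive (S (S k)) g ->
  (forall v, length v = k -> h (0%nat :: v) = f v) ->
  (forall n v, length v = k -> h (S n :: v) = g (n :: h (n :: v) :: v)) ->
  recursive (S k) h.
Proof.
  intros [ef Hf] [eg Hg] H0 HS; exists (PRec ef eg).
  intros [|n v] Hv; [discriminate|]; injection Hv as Hv.
  induction n as [|n IH].
  - rewrite H0 by auto; constructor; auto.
  - rewrite HS by auto; econstructor; [exact IH|].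
    apply Hg; simpl; now rewrite Hv.
Qed.

Lemma recursive_add k f g :
  recursive k f -> recursive k g -> recursive k (fun v => f v + g v)%nat.
Proof.
  apply (recursive_comp2 k Nat.add).
  apply (recursive_prec 1 (fun v => nth 0 v 0%nat) (fun v => S (nth 1 v 0%nat)));
    [apply recursive_nth; lia
    |apply recursive_succ, recursive_nth; lia
    |reflexivity|reflexivity].
Qed.

Lemma recursive_mul k f g :
  recursive k f -> recursive k g -> recursive k (fun v => f v * g v)%nat.
Proof.
  apply (recursive_comp2 k Nat.mul).
  apply (recursive_prec 1 (fun _ => 0%nat)
           (fun v => nth 2 v 0 + nth 1 v 0)%nat);
    [apply recursive_const
    |apply recursive_add; apply recursive_nth; lia
    |reflexivity|reflexivity].
Qed.

Lemma recursive_pred k f : recursive k f -> recursive k (fun v => Nat.pred (f v)).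
Proof.
  apply (recursive_comp1 k Nat.pred).
  apply (recursive_prec 0 (fun _ => 0%nat) (fun v => nth 0 v 0%nat));
    [apply recursive_const|apply recursive_nth; lia|reflexivity|reflexivity].
Qed.

Lemma recursive_sub k f g :
  recursive k f -> recursive k g -> recursive k (fun v => f v - g v)%nat.
Proof.
  (* [recursive_prec] recurses on the head of the list, so the subtrahend has to come first. *)
  intros Hf Hg; revert Hg Hf.
  apply (recursive_comp2 k (fun y x => x - y)%nat).
  apply (recursive_prec 1 (fun v => nth 0 v 0%nat)
           (fun v => Nat.pred (nth 1 v 0%nat)));
    [apply recursive_nth; lia
    |apply recursive_pred, recursive_nth; lia
    |intros; simpl; lia|intros; simpl; lia].
Qed.

Lemma recursive_pair_code k f g :
  recursive k f -> recursive k g -> recursive k (fun v => pair_code (f v) (g v)).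
Proof.
  intros Hf Hg; apply recursive_add; [|exact Hg].
  (* Halving is avoided: triangular numbers satisfy T(n+1) = T(n) + (n+1). *)
  apply (recursive_comp1 k (fun n => n * (n + 1) / 2)%nat);
    [|now apply recursive_add].
  apply (recursive_prec 0 (fun _ => 0%nat) (fun v => nth 1 v 0 + S (nth 0 v 0))%nat).
  - apply recursive_const.
  - apply recursive_add; [|apply recursive_succ]; apply recursive_nth; lia.
  - reflexivity.
  - intros n v _; cbn [nth].
    replace (S n * (S n + 1))%nat with (n * (n + 1) + S n * 2)%nat by lia.
    now apply Nat.div_add.
Qed.

(** At most one of the two truncated differences is nonzero. The code is twice the first if z >= 0
    and twice the second minus 1 if z < 0; the truncated predecessor of 0 adds nothing in the first
    case. *)
Lemma recursive_zcode_sub k f g :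
  recursive k f -> recursive k g ->
  recursive k (fun v => zcode (Z.of_nat (f v) - Z.of_nat (g v))).
Proof.
  intros Hf Hg.
  apply (recursive_ext k
    (fun v => 2 * (f v - g v) + Nat.pred (2 * (g v - f v)))%nat).
  - intros v _; unfold zcode.
    destruct (Z.leb_spec 0 (Z.of_nat (f v) - Z.of_nat (g v))); lia.
  - apply recursive_add; [|apply recursive_pred];
      (apply recursive_mul; [apply recursive_const|now apply recursive_sub]).
Qed.

Lemma recursive_zcode_lin k f g (a b : Z) :
  recursive k f -> recursive k g ->
  recursive k (fun v => zcode (a * Z.of_nat (f v) + b * Z.of_nat (g v))).
Proof.
  intros Hf Hg.
  (* Each coefficient is split into its positive and negative parts. *)
  apply (recursive_ext k (fun v => zcode
    (Z.of_nat (Z.to_nat a * f v + Z.to_nat b * g v) -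
     Z.of_nat (Z.to_nat (- a) * f v + Z.to_nat (- b) * g v)))).
  - intros v _; f_equal; nia.
  - apply recursive_zcode_sub;
      (apply recursive_add; apply recursive_mul; auto using recursive_const).
Qed.

Lemma least_nat (P : nat -> Prop) :
  (exists n, P n) -> exists n, P n /\ forall m, (m < n)%nat -> ~ P m.
Proof.
  intros [n Hn]; revert Hn; induction n as [n IH] using lt_wf_ind; intros Hn.
  destruct (classic (exists m, (m < n)%nat /\ P m)) as [[m [Hm HP]]|H].
  - exact (IH m Hm HP).
  - exists n; split; [exact Hn|]; intros m Hm HP; apply H; eauto.
Qed.

(** Unbounded search must halt with a nonzero value at every smaller argument; totality of [f]
    guarantees that it halts there. *)
Lemma eval_least k f :
  recursive (S k) f ->
  exists e, forall v, length v = k -> (exists n, f (n :: v) = 0%nat) ->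
    exists n, eval e v n /\ f (n :: v) = 0%nat /\
      forall m, (m < n)%nat -> f (m :: v) <> 0%nat.
Proof.
  intros [e He]; exists (PMu e); intros v Hv Hex.
  destruct (least_nat _ Hex) as [n [Hn Hmin]].
  exists n; repeat split; auto.
  constructor.
  - rewrite <- Hn; apply He; simpl; auto.
  - intros m Hm; specialize (Hmin m Hm).
    destruct (f (m :: v)) as [|r] eqn:Hr; [easy|].
    exists r; rewrite <- Hr; apply He; simpl; auto.
Qed.

(** * Diophantine approximation *)

(** An equivalent of [lagrange_admissible] with positive, arbitrarily large denominators, in the
    form in which the distance from m x to an integer appears. *)
Definition unbounded_approx (x c : R) : Prop :=
  forall N : nat, exists p m : Z,
    (Z.of_nat N < m)%Z /\ Rabs (IZR m * x - IZR p) < c / IZR m.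

Lemma approx_denominator x c p m :
  (0 < m)%Z ->
  Rabs (x - IZR p / IZR m) < c / IZR m ^ 2 <-> Rabs (IZR m * x - IZR p) < c / IZR m.
Proof.
  intros Hm; apply IZR_lt in Hm.
  replace (IZR m * x - IZR p) with (IZR m * (x - IZR p / IZR m)) by (field; lra).
  rewrite Rabs_mult, (Rabs_pos_eq (IZR m)) by lra.
  replace (c / IZR m) with (IZR m * (c / IZR m ^ 2)) by (field; lra).
  split; intros H.
  - now apply Rmult_lt_compat_l.
  - now apply Rmult_lt_reg_l with (IZR m).
Qed.

Lemma list_snd_bounded (l : list (Z * Z)) :
  exists N : nat, forall p, In p l -> (snd p <= Z.of_nat N)%Z.
Proof.
  induction l as [|a l [N HN]].
  - exists 0%nat; intros p [].
  - exists (N + Z.to_nat (snd a))%nat; intros p [<-|Hp]; [|specialize (HN p Hp)]; lia.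
Qed.

Lemma admissible_of_unbounded x c : unbounded_approx x c -> lagrange_admissible x c.
Proof.
  intros H [l Hl].
  destruct (list_snd_bounded l) as [N HN].
  destruct (H N) as (p & m & Hm & Hpm).
  assert (Hin : In (p, m) l).
  { apply Hl; split; simpl; [lia|].
    apply approx_denominator; [lia|exact Hpm]. }
  specialize (HN _ Hin); simpl in HN; lia.
Qed.

Definition zrange (B : nat) : list Z :=
  map (fun n => (Z.of_nat n - Z.of_nat B)%Z) (seq 0 (2 * B + 1)).

Lemma in_zrange B z : (Z.abs z <= Z.of_nat B)%Z -> In z (zrange B).
Proof.
  intros H; apply in_map_iff; exists (Z.to_nat (z + Z.of_nat B)); split; [lia|].
  apply in_seq; lia.
Qed.

(** If the denominators stayed at most N, the numerators would be bounded by N |x| + |c|, so all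
    pairs would lie in a finite box. *)
Lemma unbounded_of_admissible x c : lagrange_admissible x c -> unbounded_approx x c.
Proof.
  intros H N; apply NNPP; intros Hno; apply H.
  destruct (INR_unbounded (INR N * Rabs x + Rabs c)) as [B HB].
  exists (list_prod (zrange B) (zrange N)).
  intros [p m] [Hm Happ]; simpl in Hm, Happ.
  (* Negating both entries leaves the fraction unchanged and makes its denominator positive. *)
  assert (Hsym : exists p' m', (0 < m')%Z /\ Z.abs p' = Z.abs p /\ Z.abs m' = Z.abs m /\
                   Rabs (IZR m' * x - IZR p') < c / IZR m').
  { destruct (Z_lt_le_dec 0 m) as [Hpos|Hneg].
    - exists p, m; repeat split; auto; now apply approx_denominator.
    - exists (- p)%Z, (- m)%Z; repeat split; try lia.
      apply approx_denominator; [lia|].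
      assert (IZR m <> 0) by now apply not_0_IZR.
      rewrite !opp_IZR.
      replace (- IZR p / - IZR m) with (IZR p / IZR m) by now field.
      now replace ((- IZR m) ^ 2) with (IZR m ^ 2) by ring. }
  destruct Hsym as (p' & m' & Hpos & Hp & Hm' & Happ').
  assert (HmN : (m' <= Z.of_nat N)%Z).
  { apply Z.nlt_ge; intros Hlt; apply Hno; eauto. }
  apply in_prod; apply in_zrange; [|lia].
  rewrite <- Hp; apply le_IZR.
  rewrite abs_IZR, <- INR_IZR_INZ.
  assert (Hm1 : 1 <= IZR m') by (apply IZR_le; lia).
  assert (HmR : IZR m' <= INR N) by (rewrite INR_IZR_INZ; now apply IZR_le).
  assert (Hc : c / IZR m' <= Rabs c).
  { apply Rle_trans with (Rabs (c / IZR m')); [apply Rle_abs|].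
    unfold Rdiv; rewrite Rabs_mult, (Rabs_pos_eq (/ IZR m')).
    - rewrite <- (Rmult_1_r (Rabs c)) at 2.
      apply Rmult_le_compat_l; [apply Rabs_pos|].
      rewrite <- Rinv_1; apply Rinv_le_contravar; lra.
    - left; apply Rinv_0_lt_compat; lra. }
  assert (Hx : Rabs (IZR m' * x) <= INR N * Rabs x).
  { rewrite Rabs_mult, (Rabs_pos_eq (IZR m')) by lra.
    apply Rmult_le_compat_r; [apply Rabs_pos|exact HmR]. }
  replace (IZR p') with (IZR m' * x - (IZR m' * x - IZR p')) by ring.
  pose proof (Rabs_triang (IZR m' * x) (- (IZR m' * x - IZR p'))) as Ht.
  rewrite Rabs_Ropp in Ht; unfold Rminus at 1; lra.
Qed.

(* Consecutive Farey fractions [a/b <= x < c/d] of order [N]; when [b + d <= N + 1]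
   the mediant replaces one of them. *)
Lemma farey_bracket x (N : nat) :
  exists a b c d : Z,
    (1 <= b <= Z.of_nat N + 1)%Z /\ (1 <= d <= Z.of_nat N + 1)%Z /\
    (Z.of_nat N + 2 <= b + d)%Z /\ (c * b - a * d = 1)%Z /\
    IZR a <= IZR b * x /\ IZR d * x < IZR c.
Proof.
  induction N as [|N (a & b & c & d & Hb & Hd & Hbd & Hdet & Ha & Hc)].
  - exists (up x - 1)%Z, 1%Z, (up x), 1%Z.
    destruct (archimed x) as [H1 H2].
    rewrite minus_IZR; repeat split; lia || lra.
  - destruct (Z_le_gt_dec (Z.of_nat N + 3) (b + d)) as [H|H].
    { exists a, b, c, d; rewrite Nat2Z.inj_succ; repeat split; auto; lia. }
    destruct (Rle_lt_dec (IZR (a + c)) (IZR (b + d) * x)) as [Hx|Hx].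
    + exists (a + c)%Z, (b + d)%Z, c, d; rewrite Nat2Z.inj_succ; repeat split; auto; lia.
    + exists a, b, (a + c)%Z, (b + d)%Z; rewrite Nat2Z.inj_succ; repeat split; auto; lia.
Qed.

(** The determinant condition gives d (b x - a) + b (c - d x) = 1. As b + d >= N + 2, the two
    distances cannot both exceed 1 / (N + 2). *)
Lemma dirichlet_approximation x (N : nat) :
  exists p q : Z, (1 <= q <= Z.of_nat N + 1)%Z /\
    Rabs (IZR q * x - IZR p) <= / (INR N + 2).
Proof.
  destruct (farey_bracket x N) as (a & b & c & d & Hb & Hd & Hbd & Hdet & Ha & Hc).
  assert (Hb1 : 1 <= IZR b) by (apply IZR_le; lia).
  assert (Hd1 : 1 <= IZR d) by (apply IZR_le; lia).
  assert (Hsum : INR N + 2 <= IZR b + IZR d).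
  { rewrite INR_IZR_INZ, <- !plus_IZR; now apply IZR_le. }
  pose proof (pos_INR N) as HN.
  apply (f_equal IZR) in Hdet; rewrite minus_IZR, !mult_IZR in Hdet.
  set (e := / (INR N + 2)).
  assert (He : e * (INR N + 2) = 1) by (unfold e; field; lra).
  assert (He0 : 0 < e) by (apply Rinv_0_lt_compat; lra).
  destruct (Rle_lt_dec (IZR b * x - IZR a) e) as [H|H].
  - exists a, b; split; [exact Hb|]; rewrite Rabs_pos_eq; lra.
  - exists c, d; split; [exact Hd|]; rewrite Rabs_left by lra.
    apply Rnot_lt_le; intros H'.
    assert (1 > e * (IZR b + IZR d)).
    { replace 1 with (IZR d * (IZR b * x - IZR a) + IZR b * (IZR c - IZR d * x)) by
        (rewrite <- Hdet; ring).
      nra. }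
    nra.
Qed.

(** * Range of the Lagrange constant, for irrational and rational numbers *)

Definition irrational (x : R) : Prop :=
  forall p m : Z, m <> 0%Z -> IZR m * x - IZR p <> 0.

Lemma list_distance_positive x (l : list (Z * Z)) :
  irrational x ->
  exists e, 0 < e /\ forall p m, In (p, m) l -> m <> 0%Z -> e <= Rabs (IZR m * x - IZR p).
Proof.
  intros Hx; induction l as [|[p0 m0] l [e [He IH]]].
  - exists 1; split; [lra|]; intros p m [].
  - destruct (Z.eq_dec m0 0) as [H0|H0].
    + exists e; split; [exact He|]; intros p m [Heq|Hin] Hm; [congruence|auto].
    + exists (Rmin e (Rabs (IZR m0 * x - IZR p0))); split.
      * apply Rmin_pos; [exact He|apply Rabs_pos_lt, Hx, H0].
      * intros p m [Heq|Hin] Hm.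
        -- injection Heq as <- <-; apply Rmin_r.
        -- eapply Rle_trans; [apply Rmin_l|auto].
Qed.

(** The pairs of a finite list stay at a positive distance e; Dirichlet's theorem with N > 1 / e
    yields a pair closer than that. *)
Lemma irrational_admissible_1 x : irrational x -> lagrange_admissible x 1.
Proof.
  intros Hx [l Hl].
  destruct (list_distance_positive x l Hx) as (e & He & Hmin).
  destruct (INR_unbounded (/ e)) as [N HN].
  destruct (dirichlet_approximation x N) as (p & q & Hq & Hpq).
  pose proof (pos_INR N) as HN0.
  assert (HqR : 1 <= IZR q <= INR N + 1).
  { rewrite INR_IZR_INZ, <- plus_IZR; split; apply IZR_le; lia. }
  assert (Hin : In (p, q) l).
  { apply Hl; split; simpl; [lia|].
    apply approx_denominator; [lia|].
    eapply Rle_lt_trans; [exact Hpq|].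
    unfold Rdiv; rewrite Rmult_1_l; apply Rinv_lt_contravar; nra. }
  specialize (Hmin p q Hin ltac:(lia)).
  assert (/ (INR N + 2) < e).
  { rewrite <- (Rinv_inv e); apply Rinv_lt_contravar; [|lra].
    apply Rmult_lt_0_compat; [now apply Rinv_0_lt_compat|lra]. }
  lra.
Qed.

Lemma admissible_pos x c : lagrange_admissible x c -> 0 < c.
Proof.
  intros H; destruct (unbounded_of_admissible x c H 0%nat) as (p & m & Hm & Hpm).
  assert (Hm' : 0 < IZR m) by (apply IZR_lt; lia).
  pose proof (Rle_lt_trans _ _ _ (Rabs_pos _) Hpm) as Hc.
  replace c with (c / IZR m * IZR m) by (field; lra); nra.
Qed.

(** Pairs are counted, not fractions: the multiples of one exact representation are infinitely many
    pairs with error 0, so every c > 0 is admissible. *)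
Lemma lagrange_const_rational x : ~ irrational x -> lagrange_const x = Finite 0.
Proof.
  intros Hx.
  assert (Hex : exists p m : Z, (0 < m)%Z /\ IZR m * x - IZR p = 0).
  { apply NNPP; intros Hno; apply Hx; intros p m Hm H0; apply Hno.
    destruct (Z_lt_le_dec 0 m).
    - now exists p, m.
    - exists (- p)%Z, (- m)%Z; rewrite !opp_IZR; split; [lia|lra]. }
  destruct Hex as (p & m & Hm & H0).
  apply is_glb_Rbar_unique; split.
  - intros c Hc; apply admissible_pos in Hc; simpl; lra.
  - intros b Hb.
    assert (Hadm : forall c, 0 < c -> lagrange_admissible x c).
    { intros c Hc; apply admissible_of_unbounded; intros N.
      exists (Z.of_nat (S N) * p)%Z, (Z.of_nat (S N) * m)%Z; split; [nia|].
      rewrite !mult_IZR.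
      replace (_ - _) with (IZR (Z.of_nat (S N)) * (IZR m * x - IZR p)) by ring.
      rewrite H0, Rmult_0_r, Rabs_R0.
      apply Rdiv_lt_0_compat; [exact Hc|].
      rewrite <- mult_IZR; apply IZR_lt; nia. }
    destruct b as [b| |]; simpl; auto.
    + apply Rnot_lt_le; intros Hb0.
      specialize (Hb (b / 2) (Hadm (b / 2) ltac:(lra))); simpl in Hb; lra.
    + exact (Hb 1 (Hadm 1 Rlt_0_1)).
Qed.

Lemma lagrange_const_irrational x :
  irrational x ->
  exists L, lagrange_const x = Finite L /\ 0 <= L <= 1 /\
    (forall c, lagrange_admissible x c -> L <= c) /\
    (forall c, L < c -> exists c', c' < c /\ lagrange_admissible x c').
Proof.
  intros Hx; pose proof (irrational_admissible_1 x Hx) as H1.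
  destruct (Glb_Rbar_correct (lagrange_admissible x)) as [Hlb Hglb].
  unfold lagrange_const.
  assert (H0 : Rbar_le 0 (Glb_Rbar (lagrange_admissible x))).
  { apply Hglb; intros c Hc; apply admissible_pos in Hc; simpl; lra. }
  specialize (Hlb 1 H1) as Hle1.
  destruct (Glb_Rbar (lagrange_admissible x)) as [L| |]; simpl in *; try easy.
  exists L; split; [reflexivity|split; [lra|split]].
  - intros c Hc; exact (Hlb c Hc).
  - intros c Hc; apply NNPP; intros Hno.
    assert (Hle : Rbar_le c L).
    { apply Hglb; intros c' Hc'; simpl; apply Rnot_lt_le; intros Hlt.
      apply Hno; eauto. }
    simpl in Hle; lra.
Qed.

(** * The order-6 sequences *)

Fixpoint gauss_pow (a b : Z) (n : nat) : Z * Z :=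
  match n with
  | O => (1, 0)%Z
  | S n => let (x, y) := gauss_pow a b n in (a * x - b * y, b * x + a * y)%Z
  end.

(* The scaled sequence [d^n (r2 n (1 - cos (n theta)) - r1 sin (n theta))] for
   [a + b i = d exp (i theta)]. *)
Definition up_seq (a b d r1 r2 : Z) (n : nat) : Z :=
  (r2 * Z.of_nat n * (d ^ Z.of_nat n - fst (gauss_pow a b n)) -
   r1 * snd (gauss_pow a b n))%Z.

(* Characteristic polynomial [(X - d)^2 (X^2 - 2 a X + a^2 + b^2)^2]. *)
Definition up_coeffs (a b d : Z) : list Z :=
  let s := (a * a + b * b)%Z in
  [4 * a + 2 * d;
   - (4 * a * a + 2 * s + 8 * a * d + d * d);
   4 * a * s + 2 * d * (4 * a * a + 2 * s) + 4 * a * d * d;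
   - (s * s + 8 * a * d * s + d * d * (4 * a * a + 2 * s));
   2 * d * s * s + 4 * a * s * d * d;
   - (d * d * s * s)]%Z.

Definition up_init (a b d r1 r2 : Z) : list Z := map (up_seq a b d r1 r2) (seq 0 6).

Lemma lrs_up_seq a b d r1 r2 n :
  lrs (up_coeffs a b d) (up_init a b d r1 r2) n = up_seq a b d r1 r2 n.
Proof.
  unfold lrs.
  (* The state after n steps is the window of six consecutive terms from n on. The recurrence then
     becomes a polynomial identity in n, d^n and the two parts of (a + b i)^n. *)
  enough (H : Nat.iter n (lrs_step (up_coeffs a b d)) (up_init a b d r1 r2) =
          map (up_seq a b d r1 r2) (seq n 6)) by now rewrite H.
  induction n as [|n IH]; [reflexivity|].
  simpl Nat.iter; rewrite IH; unfold lrs_step, up_coeffs.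
  cbn [map combine rev app tl fold_right fst snd seq]; do 6 f_equal.
  unfold up_seq; simpl gauss_pow.
  destruct (gauss_pow a b n) as [x y]; simpl fst; simpl snd.
  rewrite !Nat2Z.inj_succ, !Z.pow_succ_r by lia.
  ring.
Qed.

Lemma ultimately_nonneg_up_seq a b d r1 r2 :
  ultimately_nonneg (up_coeffs a b d) (up_init a b d r1 r2) <->
  exists N, forall n, (N <= n)%nat -> (0 <= up_seq a b d r1 r2 n)%Z.
Proof.
  unfold ultimately_nonneg; split; intros [N HN]; exists N; intros n Hn;
    [rewrite <- lrs_up_seq|rewrite lrs_up_seq]; auto.
Qed.

(** A total function obtained by excluded middle; the oracle computes it on valid inputs. *)
Definition upp_verdict (a u : list Z) : nat :=
  if excluded_middle_informative (ultimately_nonneg a u) then 1%nat else 0%nat.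

(** For fixed a, b, d the coefficients are constants and the initial terms are linear in r1 and r2,
    so the input of the oracle is computable. The sign [s] covers both sequences of the test. *)
Lemma recursive_upp_verdict a b d (s : Z) k f g :
  UPP_decidable 6 -> d <> 0%Z -> b <> 0%Z -> recursive k f -> recursive k g ->
  recursive k (fun v => upp_verdict (up_coeffs a b d)
    (up_init a b d (s * Z.of_nat (f v)) (Z.of_nat (g v)))).
Proof.
  intros [e He] Hd Hb Hf Hg.
  set (z := fun i => gauss_pow a b i).
  set (fs := map (fun c (_ : list nat) => zcode c) (up_coeffs a b d) ++
    map (fun i v => zcode ((- s * snd (z i))%Z * Z.of_nat (f v) +
           (Z.of_nat i * (d ^ Z.of_nat i - fst (z i)))%Z * Z.of_nat (g v))) (seq 0 6)).
  destruct (recursive_evals k fs) as [es Hes].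
  { apply Forall_app; split; apply Forall_map, List.Forall_forall; intros c _.
    - apply recursive_const.
    - now apply recursive_zcode_lin. }
  exists (PComp e es); intros v Hv; econstructor; [exact (Hes v Hv)|].
  set (u := up_init a b d (s * Z.of_nat (f v)) (Z.of_nat (g v))).
  replace (map (fun h => h v) fs) with (map zcode (up_coeffs a b d ++ u)).
  2:{ unfold fs, u, up_init; rewrite !map_app, !map_map; f_equal.
      apply map_ext; intros i; f_equal; unfold up_seq, z; ring. }
  destruct (He (up_coeffs a b d) u) as [H1 H0].
  (* The last coefficient is - d^2 (a^2 + b^2)^2, nonzero because d and b are. *)
  { repeat split; simpl.
    assert (0 < d * d)%Z by nia.
    assert (0 < a * a + b * b)%Z by nia.
    assert (0 < d * d * (a * a + b * b) * (a * a + b * b))%Z by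
      (apply Z.mul_pos_pos; [apply Z.mul_pos_pos|]; assumption).
    lia. }
  unfold upp_verdict; destruct (excluded_middle_informative _); auto.
Qed.

(** * Polar form of the terms and trigonometric estimates *)

Lemma gauss_pow_polar a b d theta n :
  IZR a = IZR d * cos theta -> IZR b = IZR d * sin theta ->
  IZR (fst (gauss_pow a b n)) = IZR d ^ n * cos (INR n * theta) /\
  IZR (snd (gauss_pow a b n)) = IZR d ^ n * sin (INR n * theta).
Proof.
  intros Ha Hb; induction n as [|n [IHc IHs]].
  - simpl; rewrite Rmult_0_l, cos_0, sin_0; lra.
  - simpl gauss_pow; destruct (gauss_pow a b n) as [x y]; simpl fst in *; simpl snd in *.
    rewrite minus_IZR, plus_IZR, !mult_IZR, IHc, IHs, Ha, Hb, S_INR.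
    rewrite Rmult_plus_distr_r, Rmult_1_l, cos_plus, sin_plus; simpl; split; ring.
Qed.

Lemma cos_sin_period_Z x (p : Z) :
  cos (x + 2 * IZR p * PI) = cos x /\ sin (x + 2 * IZR p * PI) = sin x.
Proof.
  destruct (Z_le_gt_dec 0 p) as [Hp|Hp].
  - rewrite <- (Z2Nat.id p), <- INR_IZR_INZ by lia.
    now rewrite cos_period, sin_period.
  - set (k := Z.to_nat (- p)).
    rewrite <- (cos_period (x + 2 * IZR p * PI) k), <- (sin_period (x + 2 * IZR p * PI) k).
    replace (x + 2 * IZR p * PI + 2 * INR k * PI) with x; [easy|].
    unfold k; rewrite INR_IZR_INZ, Z2Nat.id, opp_IZR by lia; ring.
Qed.

Lemma up_seq_polar a b d r1 r2 t n p y :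
  IZR a = IZR d * cos (2 * PI * t) -> IZR b = IZR d * sin (2 * PI * t) ->
  y = PI * (INR n * t - IZR p) ->
  IZR (up_seq a b d r1 r2 n) =
    2 * IZR d ^ n * (sin y * (IZR r2 * INR n * sin y - IZR r1 * cos y)).
Proof.
  intros Ha Hb Hy.
  destruct (gauss_pow_polar a b d (2 * PI * t) n Ha Hb) as [Hc Hs].
  unfold up_seq.
  rewrite !minus_IZR, !mult_IZR, minus_IZR, <- pow_IZR, Hc, Hs, <- INR_IZR_INZ.
  (* Modulo 2 pi the angle is 2 y, and the half-angle formulas extract the factor sin y. *)
  replace (INR n * (2 * PI * t)) with (2 * y + 2 * IZR p * PI) by (rewrite Hy; ring).
  destruct (cos_sin_period_Z (2 * y) p) as [-> ->].
  rewrite cos_2a_sin, sin_2a; ring.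
Qed.

(** This is y <= tan y cleared of its denominator: sin z - z cos z has derivative z sin z >= 0. *)
Lemma mul_cos_le_sin y : 0 <= y <= PI / 2 -> y * cos y <= sin y.
Proof.
  intros [[Hy| <-] Hy2]; [|rewrite sin_0; lra].
  destruct (MVT_cor2 (fun z => sin z - z * cos z) (fun z => z * sin z) 0 y Hy)
    as (z & Hz & Hz1 & Hz2).
  - intros z _; apply is_derive_Reals; auto_derive; auto; ring.
  - rewrite sin_0 in Hz.
    assert (0 <= z * sin z) by (apply Rmult_le_pos; [lra|apply sin_ge_0; lra]).
    nra.
Qed.

(** With s = sin (y / 2), cos y = 1 - 2 s^2. If s >= 0 then 2 s^2 <= 2 s <= y; if s < 0 then y > 2
    >= 2 s^2. *)
Lemma one_sub_le_cos y : 0 <= y -> 1 - y <= cos y.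
Proof.
  intros [Hy| <-]; [|rewrite cos_0; lra].
  replace y with (2 * (y / 2)) at 2 by field; rewrite cos_2a_sin.
  pose proof (sin_lt_x (y / 2) ltac:(lra)).
  pose proof (SIN_bound (y / 2)).
  destruct (Rle_lt_dec 0 (sin (y / 2))); [nra|].
  destruct (Rle_lt_dec y 2); [|nra].
  pose proof (sin_ge_0 (y / 2) ltac:(lra) ltac:(pose proof PI2_1; lra)); lra.
Qed.

(** For y >= 0 negativity forces m y cos y <= m sin y < r cos y, hence m y < r. The case y < 0
    follows by negating both y and r. *)
Lemma small_angle_of_neg y m r :
  - (PI / 2) <= y <= PI / 2 -> 0 < m ->
  sin y * (m * sin y - r * cos y) < 0 -> m * Rabs y < Rabs r.
Proof.
  assert (Hpos : forall y r, 0 <= y <= PI / 2 -> 0 < m ->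
    sin y * (m * sin y - r * cos y) < 0 -> m * Rabs y < Rabs r).
  { clear; intros y r Hy Hm H.
    pose proof (mul_cos_le_sin y Hy) as Hsin.
    assert (Hs : 0 <= sin y) by (apply sin_ge_0; pose proof PI_RGT_0; lra).
    assert (Hc : 0 <= cos y) by (apply cos_ge_0; lra).
    assert (Hlt : m * sin y - r * cos y < 0) by nra.
    rewrite (Rabs_pos_eq y) by lra.
    apply Rlt_le_trans with r; [|apply Rle_abs].
    apply Rnot_le_lt; intros Hr; nra. }
  intros Hy Hm H; destruct (Rle_lt_dec 0 y) as [Hy0|Hy0]; [apply Hpos; auto; lra|].
  rewrite <- (Rabs_Ropp y), <- (Rabs_Ropp r); apply Hpos; auto; [lra|].
  rewrite sin_neg, cos_neg; nra.
Qed.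

(** The last hypothesis gives r y < r - c, so n sin y < n y < c < r (1 - y) <= r cos y. *)
Lemma neg_of_small_angle y n c r :
  0 < y -> 0 < n -> n * y < c -> 0 < c < r -> r * r < n * (r - c) ->
  sin y * (n * sin y - r * cos y) < 0.
Proof.
  intros Hy Hn Hny Hcr Hbig.
  assert (Hy1 : r * y < r - c).
  { apply Rmult_lt_reg_l with n; [exact Hn|]; nra. }
  assert (Hy2 : y < 1) by nra.
  pose proof (one_sub_le_cos y ltac:(lra)).
  pose proof (sin_lt_x y Hy).
  assert (0 < sin y) by (apply sin_gt_0; pose proof PI2_1; lra).
  assert (n * sin y < n * y) by (apply Rmult_lt_compat_l; lra).
  assert (r * (1 - y) <= r * cos y) by (apply Rmult_le_compat_l; lra).
  nra.
Qed.

(** * From the signs of the terms to admissible constants and back *)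

Lemma nearest_integer x : exists p : Z, Rabs (x - IZR p) <= / 2.
Proof.
  destruct (archimed (x - / 2)) as [H1 H2].
  exists (up (x - / 2)); apply Rabs_le; lra.
Qed.

Lemma admissible_of_not_ultimately_nonneg a b d (r1 r2 : Z) t :
  IZR a = IZR d * cos (2 * PI * t) -> IZR b = IZR d * sin (2 * PI * t) ->
  (0 < d)%Z -> (0 < r2)%Z ->
  ~ ultimately_nonneg (up_coeffs a b d) (up_init a b d r1 r2) ->
  lagrange_admissible t (Rabs (IZR r1) / IZR r2 / PI).
Proof.
  intros Ha Hb Hd Hr2 H.
  apply admissible_of_unbounded; intros N; apply NNPP; intros Hno; apply H.
  apply ultimately_nonneg_up_seq; exists (S N); intros n Hn.
  apply Z.nlt_ge; intros Hneg; apply Hno.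
  destruct (nearest_integer (INR n * t)) as [p Hp].
  exists p, (Z.of_nat n); split; [lia|].
  rewrite <- INR_IZR_INZ.
  apply IZR_lt in Hneg, Hd, Hr2.
  set (y := PI * (INR n * t - IZR p)).
  rewrite (up_seq_polar a b d r1 r2 t n p y Ha Hb eq_refl) in Hneg.
  assert (Hn0 : 0 < INR n) by (apply lt_0_INR; lia).
  pose proof PI_RGT_0 as HPI.
  assert (HD : 0 < 2 * IZR d ^ n) by (apply Rmult_lt_0_compat; [lra|now apply pow_lt]).
  assert (Hsmall : IZR r2 * INR n * Rabs y < Rabs (IZR r1)).
  { apply small_angle_of_neg.
    (* Taking p nearest to n t is what keeps y within [-pi/2, pi/2]. *)
    - apply Rabs_le_between in Hp; destruct Hp as [Hp1 Hp2].
      apply (Rmult_le_compat_l PI) in Hp1, Hp2; unfold y; lra.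
    - now apply Rmult_lt_0_compat.
    - apply Rmult_lt_reg_l with (2 * IZR d ^ n); [exact HD|lra]. }
  unfold y in Hsmall; rewrite Rabs_mult, (Rabs_pos_eq PI) in Hsmall by lra.
  apply Rmult_lt_reg_l with (IZR r2 * INR n * PI).
  - apply Rmult_lt_0_compat; [now apply Rmult_lt_0_compat|exact HPI].
  - replace (IZR r2 * INR n * PI * (Rabs (IZR r1) / IZR r2 / PI / INR n))
      with (Rabs (IZR r1)) by (field; lra).
    lra.
Qed.

(** A good approximation with a large denominator n makes one of the two terms of index n negative:
    the one for r1 if y > 0, the one for -r1 if y < 0. *)
Lemma not_ultimately_nonneg_of_admissible a b d (r1 r2 : Z) t c :
  IZR a = IZR d * cos (2 * PI * t) -> IZR b = IZR d * sin (2 * PI * t) ->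
  (0 < d)%Z -> (0 < r2)%Z -> irrational t ->
  lagrange_admissible t c -> PI * c < IZR r1 / IZR r2 ->
  ultimately_nonneg (up_coeffs a b d) (up_init a b d r1 r2) ->
  ultimately_nonneg (up_coeffs a b d) (up_init a b d (- r1) r2) -> False.
Proof.
  intros Ha Hb Hd Hr2 Ht Hc Hcr HU HV.
  apply ultimately_nonneg_up_seq in HU, HV.
  destruct HU as [N1 HU], HV as [N2 HV].
  pose proof (admissible_pos t c Hc) as Hc0.
  apply IZR_lt in Hd, Hr2.
  set (r := IZR r1 / IZR r2) in *.
  assert (Hr1 : IZR r1 = IZR r2 * r) by (unfold r; field; lra).
  (* Beyond N3 the index satisfies the size condition of [neg_of_small_angle]. *)
  destruct (INR_unbounded (r * r / (r - PI * c))) as [N3 HN3].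
  destruct (unbounded_of_admissible t c Hc (N1 + N2 + N3)%nat) as (p & m & Hm & Hpm).
  set (n := Z.to_nat m).
  assert (Hmn : IZR m = INR n) by (unfold n; rewrite INR_IZR_INZ, Z2Nat.id; auto; lia).
  rewrite Hmn in Hpm.
  assert (Hn : (N1 + N2 + N3 < n)%nat) by lia.
  specialize (HU n ltac:(lia)); specialize (HV n ltac:(lia)).
  apply IZR_le in HU, HV.
  pose proof PI_RGT_0 as HPI.
  assert (Hn0 : 0 < INR n) by (apply lt_0_INR; lia).
  set (y := PI * (INR n * t - IZR p)) in *.
  rewrite (up_seq_polar a b d r1 r2 t n p y Ha Hb eq_refl) in HU.
  rewrite (up_seq_polar a b d (- r1) r2 t n p y Ha Hb eq_refl), opp_IZR in HV.
  rewrite Hr1 in HU, HV.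
  assert (HD : 0 < 2 * IZR d ^ n * IZR r2).
  { apply Rmult_lt_0_compat; [|exact Hr2].
    apply Rmult_lt_0_compat; [lra|now apply pow_lt]. }
  assert (Hny : INR n * Rabs y < PI * c).
  { unfold y; rewrite Rabs_mult, (Rabs_pos_eq PI) by lra.
    apply Rmult_lt_reg_l with (/ (PI * INR n)).
    - apply Rinv_0_lt_compat; nra.
    - replace (/ (PI * INR n) * (INR n * (PI * Rabs (INR n * t - IZR p))))
        with (Rabs (INR n * t - IZR p)) by (field; lra).
      replace (/ (PI * INR n) * (PI * c)) with (c / INR n) by (field; lra).
      exact Hpm. }
  assert (Hbig : r * r < INR n * (r - PI * c)).
  { assert (INR N3 <= INR n) by (apply le_INR; lia).
    replace (r * r) with (r * r / (r - PI * c) * (r - PI * c)) by (field; lra).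
    apply Rmult_lt_compat_r; lra. }
  assert (Hpc : 0 < PI * c) by nra.
  (* At y = 0 both terms would vanish; irrationality excludes this. *)
  assert (Hy0 : y <> 0).
  { unfold y; intros H0; apply Rmult_integral in H0 as [H0|H0]; [lra|].
    rewrite <- Hmn in H0; revert H0; apply Ht; lia. }
  destruct (Rle_lt_dec 0 y) as [Hy|Hy].
  - rewrite (Rabs_pos_eq y) in Hny by exact Hy.
    pose proof (neg_of_small_angle y (INR n) (PI * c) r ltac:(lra) Hn0 Hny
      (conj Hpc Hcr) Hbig) as Hneg.
    apply (Rmult_lt_compat_l _ _ _ HD) in Hneg; lra.
  - rewrite (Rabs_left y) in Hny by exact Hy.
    pose proof (neg_of_small_angle (- y) (INR n) (PI * c) r ltac:(lra) Hn0 Hny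
      (conj Hpc Hcr) Hbig) as Hneg.
    rewrite sin_neg, cos_neg in Hneg.
    apply (Rmult_lt_compat_l _ _ _ HD) in Hneg; lra.
Qed.

(** * Computing the Lagrange constant *)

(* [leibniz_num n / leibniz_den n] is the sum of [8 / ((4 i + 1) (4 i + 3))] for [i < n],
   i.e. the Leibniz series for [PI] with consecutive terms paired. *)
Fixpoint leibniz_den (n : nat) : nat :=
  match n with
  | O => 1
  | S n => leibniz_den n * ((4 * n + 1) * (4 * n + 3))
  end%nat.

Fixpoint leibniz_num (n : nat) : nat :=
  match n with
  | O => 0
  | S n => leibniz_num n * ((4 * n + 1) * (4 * n + 3)) + 8 * leibniz_den n
  end%nat.

Definition leibniz (n : nat) : R := INR (leibniz_num n) / INR (leibniz_den n).

Lemma leibniz_den_pos n : (0 < leibniz_den n)%nat.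
Proof. induction n as [|n IH]; simpl; [lia|nia]. Qed.

Lemma leibniz_succ n :
  leibniz (S n) = leibniz n + 8 / ((4 * INR n + 1) * (4 * INR n + 3)).
Proof.
  unfold leibniz; cbn [leibniz_num leibniz_den].
  pose proof (lt_0_INR _ (leibniz_den_pos n)); pose proof (pos_INR n).
  rewrite plus_INR, !mult_INR, !plus_INR, !mult_INR.
  replace (INR 4) with 4 by (simpl; ring).
  replace (INR 8) with 8 by (simpl; ring).
  replace (INR 3) with 3 by (simpl; ring).
  replace (INR 1) with 1 by reflexivity.
  field; lra.
Qed.

Lemma leibniz_sum n : leibniz (S n) = 4 * sum_f_R0 (tg_alt PI_tg) (S (2 * n)).
Proof.
  induction n as [|n IH].
  - rewrite leibniz_succ; unfold leibniz, tg_alt, PI_tg; simpl; field.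
  - rewrite leibniz_succ, IH.
    replace (2 * S n)%nat with (S (S (2 * n))) by lia.
    rewrite (tech5 _ (S (S (2 * n)))), (tech5 _ (S (2 * n))).
    unfold tg_alt at 3 4, PI_tg.
    replace (S (S (2 * n))) with (2 * S n)%nat by lia.
    rewrite pow_1_odd, pow_1_even, !plus_INR, !mult_INR, !S_INR, !mult_INR, !S_INR.
    pose proof (pos_INR n); simpl (INR 0); field; lra.
Qed.

(** Consecutive partial sums of the alternating series bracket pi, and the paired sum is the lower
    one; they differ by 4 / (4 n + 3). The paired sums increase from 8/3. *)
Lemma leibniz_bounds n :
  8 / 3 <= leibniz (S n) <= PI /\ PI <= leibniz (S n) + 4 / (4 * INR n + 3).
Proof.
  assert (Hlow : 8 / 3 <= leibniz (S n)).
  { induction n as [|n IH].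
    - rewrite leibniz_succ; unfold leibniz; simpl; lra.
    - rewrite leibniz_succ.
      pose proof (pos_INR (S n)).
      assert (0 < 8 / ((4 * INR (S n) + 1) * (4 * INR (S n) + 3))); [|lra].
      apply Rdiv_lt_0_compat; nra. }
  pose proof (PI_ineq n) as [H1 H2].
  pose proof (leibniz_sum n) as Hsum; rewrite tech5 in Hsum, H1.
  assert (Hlast : tg_alt PI_tg (S (2 * n)) = - / (4 * INR n + 3)).
  { unfold tg_alt, PI_tg; rewrite pow_1_odd.
    replace (2 * S (2 * n) + 1)%nat with (4 * n + 3)%nat by lia.
    rewrite plus_INR, mult_INR.
    pose proof (pos_INR n); simpl; field; lra. }
  rewrite Hlast in Hsum, H1; unfold Rdiv; lra.
Qed.

Lemma recursive_leibniz_den k f :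
  recursive k f -> recursive k (fun v => leibniz_den (f v)).
Proof.
  apply (recursive_comp1 k leibniz_den).
  apply (recursive_prec 0 (fun _ => 1%nat)
    (fun v => nth 1 v 0 * ((4 * nth 0 v 0 + 1) * (4 * nth 0 v 0 + 3)))%nat).
  - apply recursive_const.
  - repeat first [apply recursive_mul | apply recursive_add | apply recursive_const
      | apply recursive_nth; lia].
  - reflexivity.
  - reflexivity.
Qed.

Lemma recursive_leibniz_num k f :
  recursive k f -> recursive k (fun v => leibniz_num (f v)).
Proof.
  apply (recursive_comp1 k leibniz_num).
  apply (recursive_prec 0 (fun _ => 0%nat)
    (fun v => nth 1 v 0 * ((4 * nth 0 v 0 + 1) * (4 * nth 0 v 0 + 3)) +
              8 * leibniz_den (nth 0 v 0))%nat).
  - apply recursive_const.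
  - repeat first [apply recursive_mul | apply recursive_add | apply recursive_const
      | apply recursive_leibniz_den | apply recursive_nth; lia].
  - reflexivity.
  - reflexivity.
Qed.

(** The product is 0 when at least one of the two sequences is negative infinitely often, so that
    the search for a zero stops there. *)
Definition lagrange_test (a b d : Z) (r1 r2 : nat) : nat :=
  upp_verdict (up_coeffs a b d) (up_init a b d (1 * Z.of_nat r1) (Z.of_nat r2)) *
  upp_verdict (up_coeffs a b d) (up_init a b d (-1 * Z.of_nat r1) (Z.of_nat r2)).

Lemma lagrange_test_zero a b d t (r1 r2 : nat) :
  IZR a = IZR d * cos (2 * PI * t) -> IZR b = IZR d * sin (2 * PI * t) ->
  (0 < d)%Z -> (0 < r2)%nat -> lagrange_test a b d r1 r2 = 0%nat ->
  lagrange_admissible t (INR r1 / INR r2 / PI).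
Proof.
  intros Ha Hb Hd Hr2 H.
  assert (Hadm : forall s, Rabs (IZR s) = 1 ->
    ~ ultimately_nonneg (up_coeffs a b d)
        (up_init a b d (s * Z.of_nat r1) (Z.of_nat r2)) ->
    lagrange_admissible t (INR r1 / INR r2 / PI)).
  { intros s Hs Hno.
    apply admissible_of_not_ultimately_nonneg with (t := t) in Hno; auto; [|lia].
    rewrite mult_IZR, Rabs_mult, Hs, Rmult_1_l, <- !INR_IZR_INZ, Rabs_pos_eq in Hno
      by apply pos_INR.
    exact Hno. }
  unfold lagrange_test, upp_verdict in H.
  destruct (excluded_middle_informative _) as [_|H1] in H;
    [destruct (excluded_middle_informative _) as [_|H2] in H; [easy|]|].
  - apply (Hadm (-1)%Z); [|exact H2].
    rewrite Rabs_left; lra.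
  - apply (Hadm 1%Z); [|exact H1].
    apply Rabs_R1.
Qed.

Lemma lagrange_test_nonzero a b d t c (r1 r2 : nat) :
  IZR a = IZR d * cos (2 * PI * t) -> IZR b = IZR d * sin (2 * PI * t) ->
  (0 < d)%Z -> (0 < r2)%nat -> irrational t -> lagrange_admissible t c ->
  lagrange_test a b d r1 r2 <> 0%nat -> INR r1 / INR r2 <= PI * c.
Proof.
  intros Ha Hb Hd Hr2 Ht Hc H.
  apply Rnot_lt_le; intros Hlt; apply H; unfold lagrange_test, upp_verdict.
  destruct (excluded_middle_informative _) as [HU|_]; [|reflexivity].
  destruct (excluded_middle_informative _) as [HV|_]; [exfalso|reflexivity].
  rewrite !INR_IZR_INZ in Hlt.
  rewrite Z.mul_1_l in HU.
  replace (-1 * Z.of_nat r1)%Z with (- Z.of_nat r1)%Z in HV by lia.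
  apply (not_ultimately_nonneg_of_admissible a b d (Z.of_nat r1) (Z.of_nat r2) t c);
    auto; lia.
Qed.

(** Here q approximates pi from below, x is the grid point found and y the one before it. With e the
    grid step, q (x - L) <= (pi - q) L + q e and pi - q <= e, so 0 <= x - L <= 8 e < 1 / D. *)
Lemma search_error (L q x y : R) (D : R) :
  0 <= L <= 1 -> 1 <= D ->
  8 / 3 <= q <= PI -> PI <= q + 4 / (4 * (8 * D + 8) + 3) ->
  PI * L <= x * q -> y * q <= PI * L -> x <= y + / (8 * D + 8) ->
  Rabs (x - L) < / D.
Proof.
  intros HL HD Hq HPI Hx Hy Hxy.
  pose proof PI_4 as HPI4.
  set (e := / (8 * D + 8)) in *.
  assert (He : e * (8 * D + 8) = 1) by (unfold e; field; lra).
  assert (He0 : 0 < e) by (apply Rinv_0_lt_compat; lra).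
  assert (HeD : 8 * e < / D).
  { apply Rmult_lt_reg_r with D; [lra|].
    rewrite Rinv_l by lra; lra. }
  assert (Hqe : PI - q <= e).
  { apply Rle_trans with (4 / (4 * (8 * D + 8) + 3)); [lra|].
    apply Rmult_le_reg_r with (4 * (8 * D + 8) + 3); [lra|].
    replace (4 / (4 * (8 * D + 8) + 3) * (4 * (8 * D + 8) + 3)) with 4 by (field; lra).
    lra. }
  assert (HxL : L <= x) by nra.
  rewrite Rabs_pos_eq by lra.
  assert (Hdiff : q * (x - L) <= (PI - q) * L + q * e) by nra.
  assert ((PI - q) * L <= e) by nra.
  assert (x - L <= 8 * e) by nra.
  lra.
Qed.

Lemma computable_lagrange_const a b d t L :
  UPP_decidable 6 ->
  IZR a = IZR d * cos (2 * PI * t) -> IZR b = IZR d * sin (2 * PI * t) ->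
  (0 < d)%Z -> b <> 0%Z -> irrational t ->
  0 <= L <= 1 ->
  (forall c, lagrange_admissible t c -> L <= c) ->
  (forall c, L < c -> exists c', c' < c /\ lagrange_admissible t c') ->
  computable_real L.
Proof.
  intros Hupp Ha Hb Hd Hb0 Ht HL Hlb Hglb.
  set (M := fun D => (8 * D + 8)%nat).
  (* The threshold [r1 / r2] is [leibniz (S M) * j / M], close to [PI * j / M]. *)
  set (r1 := fun j D => (j * leibniz_num (S (M D)))%nat).
  set (r2 := fun D => (M D * leibniz_den (S (M D)))%nat).
  assert (Hr : forall j D, INR (r1 j D) / INR (r2 D) = INR j / INR (M D) * leibniz (S (M D))).
  { intros j D; unfold r1, r2, leibniz; rewrite !mult_INR.
    pose proof (lt_0_INR _ (leibniz_den_pos (S (M D)))).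
    assert (0 < INR (M D)) by (apply lt_0_INR; unfold M; lia).
    field; lra. }
  assert (Hr2 : forall D, (0 < r2 D)%nat).
  { intros D; apply Nat.mul_pos_pos; [unfold M; lia|apply leibniz_den_pos]. }
  (* The three arguments are the search index j, the code of the numerator of eps, and its
     denominator D. *)
  assert (HM : recursive 3 (fun v => M (nth 2 v 0%nat))).
  { apply recursive_add; [apply recursive_mul|]; try apply recursive_const.
    apply recursive_nth; lia. }
  assert (Htest : recursive 3 (fun v =>
    lagrange_test a b d (r1 (nth 0 v 0%nat) (nth 2 v 0%nat)) (r2 (nth 2 v 0%nat)))).
  { assert (Hf : recursive 3 (fun v => r1 (nth 0 v 0%nat) (nth 2 v 0%nat))).
    { apply recursive_mul; [apply recursive_nth; lia|].
      now apply recursive_leibniz_num, recursive_succ. }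
    assert (Hg : recursive 3 (fun v => r2 (nth 2 v 0%nat))).
    { apply recursive_mul; [exact HM|].
      now apply recursive_leibniz_den, recursive_succ. }
    apply recursive_mul; apply recursive_upp_verdict; auto; lia. }
  destruct (eval_least 2 _ Htest) as [search Hsearch].
  assert (Hout : recursive 3 (fun v =>
    pair_code (zcode (Z.of_nat (nth 0 v 0%nat))) (M (nth 2 v 0%nat)))).
  { apply recursive_pair_code; [|exact HM].
    apply (recursive_ext 3 (fun v => (2 * nth 0 v 0)%nat)).
    - intros v _; unfold zcode; destruct (Z.leb_spec 0 (Z.of_nat (nth 0 v 0%nat))); lia.
    - apply recursive_mul; [apply recursive_const|apply recursive_nth; lia]. }
  destruct Hout as [out Hout].
  exists (PComp out [search; PProj 0; PProj 1]); intros eps Heps.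
  set (D := Pos.to_nat (Qden eps)).
  assert (HD : (1 <= D)%nat) by (unfold D; lia).
  assert (HDR : 1 <= INR D) by (apply (le_INR 1); exact HD).
  assert (HMR : INR (M D) = 8 * INR D + 8).
  { unfold M; rewrite plus_INR, mult_INR; simpl; ring. }
  destruct (leibniz_bounds (M D)) as [Hq HqPI].
  pose proof PI_4 as HPI4; pose proof PI_RGT_0 as HPI0.
  assert (Hlow : forall j, lagrange_test a b d (r1 j D) (r2 D) <> 0%nat ->
    INR j / INR (M D) * leibniz (S (M D)) <= PI * L).
  { intros j Hj; apply Rnot_lt_le; intros Hlt.
    destruct (Hglb (INR j / INR (M D) * leibniz (S (M D)) / PI)) as (c & Hc & Hadm).
    - apply Rmult_lt_reg_l with PI; [exact HPI0|].
      unfold Rdiv at 1; rewrite (Rmult_comm _ (/ PI)), <- Rmult_assoc, Rinv_r by lra; lra.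
    - pose proof (lagrange_test_nonzero a b d t c _ _ Ha Hb Hd (Hr2 D) Ht Hadm Hj) as Hle.
      rewrite Hr in Hle.
      apply (Rmult_lt_compat_l PI) in Hc; [|exact HPI0].
      unfold Rdiv at 1 in Hc; rewrite (Rmult_comm _ (/ PI)), <- Rmult_assoc, Rinv_r in Hc
        by lra; lra. }
  destruct (Hsearch (qinput eps) eq_refl) as (j & Hev & Hj & Hmin).
  (* At j = 2 M the threshold is at least 16/3 > 4 >= pi >= pi L, so the test must give 0. *)
  { exists (2 * M D)%nat; simpl nth; fold D.
    destruct (Nat.eq_dec (lagrange_test a b d (r1 (2 * M D)%nat D) (r2 D)) 0) as [H|H]; auto.
    apply Hlow in H; rewrite mult_INR in H; simpl (INR 2) in H.
    replace ((1 + 1) * INR (M D) / INR (M D)) with 2 in H by (field; lra).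
    nra. }
  simpl nth in Hj, Hmin; fold D in Hj, Hmin.
  exists (Z.of_nat j), (M D); split; [unfold M; lia|split].
  - eapply eval_comp; [|apply (Hout [j; zcode (Qnum eps); D]); reflexivity].
    constructor; [exact Hev|].
    constructor; [apply (eval_proj 0 (qinput eps)); simpl; lia|].
    constructor; [apply (eval_proj 1 (qinput eps)); simpl; lia|].
    constructor.
  (* A positive rational with denominator D is at least 1 / D. *)
  - apply Rlt_le_trans with (/ INR D).
    + rewrite <- INR_IZR_INZ.
      apply (search_error L (leibniz (S (M D))) (INR j / INR (M D)) (INR (j - 1) / INR (M D)));
        auto; try (rewrite <- HMR; exact HqPI).
      * pose proof (Hlb _ (lagrange_test_zero a b d t _ _ Ha Hb Hd (Hr2 D) Hj)) as Hle.
        rewrite Hr in Hle.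
        apply (Rmult_le_compat_l PI) in Hle; [|lra].
        unfold Rdiv at 1 in Hle.
        rewrite (Rmult_comm _ (/ PI)), <- Rmult_assoc, Rinv_r in Hle by lra; lra.
      (* For j = 0 the truncated j - 1 is 0 and the bound is 0 <= pi L; otherwise j - 1 failed the
         search. *)
      * destruct j as [|j].
        -- simpl; unfold Rdiv; rewrite !Rmult_0_l; nra.
        -- apply Hlow; replace (S j - 1)%nat with j by lia; apply Hmin; lia.
      * rewrite <- HMR; unfold Rdiv.
        assert (0 < / INR (M D)) by (apply Rinv_0_lt_compat; lra).
        destruct j as [|j]; [simpl; lra|].
        replace (S j - 1)%nat with j by lia; rewrite S_INR; lra.
    + unfold D, Q2R; rewrite INR_IZR_INZ, positive_nat_Z.
      assert (1 <= IZR (Qnum eps)) by (apply IZR_le; unfold Qlt in Heps; simpl in Heps; lia).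
      rewrite <- (Rmult_1_l (/ IZR (Z.pos (Qden eps)))) at 1.
      apply Rmult_le_compat_r; [|assumption].
      left; apply Rinv_0_lt_compat, IZR_lt; lia.
Qed.

Lemma computable_real_0 : computable_real 0.
Proof.
  destruct (recursive_const 2 (pair_code (zcode 0) 1)) as [e He].
  exists e; intros eps Heps; exists 0%Z, 1%nat; split; [lia|split].
  - now apply He.
  - simpl INR; unfold Rdiv; rewrite Rmult_0_l, Rminus_0_r, Rabs_R0.
    rewrite <- RMicromega.Q2R_0; now apply Qreals.Qlt_Rlt.
Qed.

Theorem theorem5p1 :
  UPP_decidable 6 ->
  forall t : R, in_T t ->
    exists L : R, lagrange_const t = Finite L /\ computable_real L.
Proof.
  intros Hupp t (p & q & theta & _ & Hq & _ & _ & Hcos & Hsin & Ht).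
  (* The case split may be classical: computability only asserts that a program exists for this
     [t]. *)
  destruct (classic (irrational t)) as [Hirr|Hrat].
  2:{ exists 0; split; [now apply lagrange_const_rational|exact computable_real_0]. }
  destruct (lagrange_const_irrational t Hirr) as (L & HL & H01 & Hlb & Hglb).
  exists L; split; [exact HL|].
  assert (Htheta : 2 * PI * t = theta).
  { rewrite Ht; field; apply PI_neq0. }
  (* p and q are brought to a common denominator d. *)
  apply (computable_lagrange_const (Qnum p * Z.pos (Qden q)) (Qnum q * Z.pos (Qden p))
           (Z.pos (Qden p) * Z.pos (Qden q)) t); auto.
  - rewrite Htheta, Hcos; unfold Q2R; rewrite !mult_IZR; field; now apply not_0_IZR.
  - rewrite Htheta, Hsin; unfold Q2R; rewrite !mult_IZR; field; now apply not_0_IZR.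
  - lia.
  - unfold Qeq in Hq; simpl in Hq; lia.
Qed.
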